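(* For every $\alpha>\sqrt{1/3}$, there is no voting rule $f$ (assigning an alternative to every preference profile, for every number of voters $n$ and alternatives $m$, and not depending on the utility distribution) such that for all $n,m$ and every symmetric distribution $\mathcal{D}$ supported on $[0,1]$, every preference profile $\sigma$ satisfies $\mathbb{E}_{\mathcal{D}}[\mathrm{sw}(f(\sigma),u)]\ge\alpha\max_{j\in A}\mathbb{E}_{\mathcal{D}}[\mathrm{sw}(j,u)]$.
   Context: There are $n$ voters and $m$ alternatives $A=\{1,\dots,m\}$. A preference profile $\sigma$ consists of a ranking of $A$ for each voter. Given a distribution $\mathcal{D}$ and profile $\sigma$, a random utility profile $u$ consistent with $\sigma$ is generated as follows: independently for each voter $i$, draw $m$ i.i.d. samples from $\mathcal{D}$ and assign them, from highest to lowest, to the alternatives in the order of voter $i$'s ranking. The social welfare of $j$ is $\mathrm{sw}(j,u)=\sum_i u_{ij}$; $\mathbb{E}_{\mathcal{D}}$ is expectation over $u$ generated with $\mathcal{D}$. A distribution $\mathcal{D}$ on $[0,1]$ is symmetric if $\Pr_{x\sim\mathcal{D}}(x\le\frac12-\epsilon)=\Pr_{x\sim\mathcal{D}}(x\ge\frac12+\epsilon)$ for all $\epsilon\in[0,\frac12]$. *)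

(* Defs.v *)
From HB Require Import structures.
From mathcomp Require Import all_boot all_order all_algebra all_fingroup.
From mathcomp Require Import all_classical all_reals all_analysis.
Set Implicit Arguments. Unset Strict Implicit. Unset Printing Implicit Defensive.
Import Order.TTheory GRing.Theory Num.Theory.
Local Open Scope classical_set_scope.
Local Open Scope ring_scope.

(* A preference profile of n voters over the alternatives 'I_m:
   voter i's ranking is a permutation, (sigma i) k = alternative ranked at
   position k (position 0 = most preferred). *)
Definition profile (n m : nat) := {ffun 'I_n -> {perm 'I_m}}.

Definition rank_pos n m (s : profile n m) (i : 'I_n) (j : 'I_m) : nat :=
  val (((s i)^-1)%g j).

(* Expectation of g(X_1,...,X_k) for X_1..X_k i.i.d. ~ D, written as the
   iterated integral (product measure via Fubini/Tonelli). *)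
Fixpoint iexp (R : realType) (D : probability R R) (k : nat)
  (g : seq R -> \bar R) : \bar R :=
  match k with
  | 0 => g [::]
  | k'.+1 => (\int[D]_x iexp D k' (fun s => g (x :: s)))%E
  end.

(* Utility profile from the n*m samples s (voter i uses block i of m samples):
   the samples are sorted from highest to lowest and assigned in the order of
   voter i's ranking. *)
Definition utility (R : realType) n m (sg : profile n m) (s : seq R)
  (i : 'I_n) (j : 'I_m) : R :=
  nth 0 (sort (fun x y : R => y <= x) (take m (drop (i * m) s)))
      (rank_pos sg i j).

Definition sw (R : realType) n m (sg : profile n m) (s : seq R) (j : 'I_m) : R :=
  \sum_(i < n) utility sg s i j.

Definition Esw (R : realType) (D : probability R R) n m (sg : profile n m)
  (j : 'I_m) : \bar R :=
  iexp D (n * m) (fun s => (sw sg s j)%:E).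

Definition supported01 (R : realType) (D : probability R R) : Prop :=
  D `[0, 1]%classic = 1%E.

Definition symmetric_distr (R : realType) (D : probability R R) : Prop :=
  forall eps : R, 0 <= eps <= 2^-1 ->
    D `]-oo, 2^-1 - eps]%classic = D `[2^-1 + eps, +oo[%classic.

Definition voting_rule := forall n m : nat, profile n m.+1 -> 'I_m.+1.

(* Main.v *)
Require Import Defs.
From HB Require Import structures.
From mathcomp Require Import all_boot all_order all_algebra all_fingroup.
From mathcomp Require Import all_classical all_reals all_analysis.
From mathcomp Require Import measurable_realfun lra ring zify.
Import Order.TTheory GRing.Theory Num.Theory.
Local Open Scope ring_scope.

(* All distributions used put mass [p / 2] on each of [0] and [1], and [1 - p] on
   [1 / 2]. With [M] alternatives and [q] fixed, the expected utilities of ranks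
   [0] and [q] tend to [1] and [1 / 2] if [p = O(1 / M)] (with a large constant,
   small compared to [q]), and both tend to [1] if [p = 1]; by symmetry the
   expected utilities of ranks [k] and [M - 1 - k] add up to [1].

   Half of the voters rank the alternative x first and y at position [q]; the
   other half put x at position [M - 1 - q] and y either at [q] (a fraction
   [kappa] of them) or last, the remaining alternatives being ranked in the order
   opposite to that of the first half. Per pair of voters, for small [p] the
   welfare is [3 / 2] for x and [(1 + kappa) / 2] for y, and for [p = 1] it is [1]
   for x, [1 + kappa] for y and at most [1] for every other alternative. Hence
   choosing y gives ratio [(1 + kappa) / 3] in the first case, any other choice at
   most [1 / (1 + kappa)] in the second, and both equal [sqrt (1 / 3)] when
   [1 + kappa = sqrt 3]. *)

Lemma atom_eqE {R : realType} :
  ((0 == 2^-1 :> R) = false) * ((2^-1 == 0 :> R) = false) *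
  ((0 == 1 :> R) = false) * ((1 == 0 :> R) = false) *
  ((2^-1 == 1 :> R) = false) * ((1 == 2^-1 :> R) = false).
Proof. by do !split; apply/negbTE/eqP => e; lra. Qed.

(** * The symmetric three-point distribution and integration against it *)

Section three_point.
Context {R : realType} (p : {i01 R}).

Definition three_point : set R -> \bar R :=
  measure_add (measure_add (mscale (p%:num / 2)%:nng \d_(0 : R))
                           (mscale (1 - p%:num)%:nng \d_(2^-1 : R)))
              (mscale (p%:num / 2)%:nng \d_(1 : R)).

HB.instance Definition _ := Measure.on three_point.

Definition three_point_mean (f : R -> R) : R :=
  p%:num / 2 * f 0 + (1 - p%:num) * f 2^-1 + p%:num / 2 * f 1.

Lemma three_pointE A :
  three_point A = (three_point_mean (\1_A : R -> R))%:E.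
Proof.
rewrite /three_point measure_addE /three_point_mean EFinD; congr (_ + _)%E.
exact: measure_addE.
Qed.

Lemma three_point_setT : three_point setT = 1%E.
Proof.
by rewrite three_pointE /three_point_mean indicT /=; congr EFin; lra.
Qed.

HB.instance Definition _ :=
  Measure_isProbability.Build _ _ R three_point three_point_setT.

Lemma supported01_three_point : supported01 three_point.
Proof.
rewrite /supported01 /= three_pointE /three_point_mean.
have mem01 (x : R) : 0 <= x <= 1 -> (x \in `[0, 1]%classic) = true.
  by move=> x01; apply: mem_set; rewrite /= in_itv.
rewrite !indicE !mem01 /=; [congr EFin; lra | lra..].
Qed.

Lemma symmetric_three_point : symmetric_distr three_point.
Proof.
move=> e /andP[e0 e1]; rewrite /= !three_pointE /three_point_mean.
rewrite !indicE; congr EFin.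
have -> : (0 \in `]-oo, (2^-1 - e)]%classic) = (1 \in `[(2^-1 + e), +oo[%classic).
  by apply/idP/idP => /set_mem; rewrite /= in_itv/= ?andbT => h; apply/mem_set;
    rewrite /= in_itv/= ?andbT; lra.
have -> : (2^-1 \in `]-oo, (2^-1 - e)]%classic) =
          (2^-1 \in `[(2^-1 + e), +oo[%classic).
  by apply/idP/idP => /set_mem; rewrite /= in_itv/= ?andbT => h; apply/mem_set;
    rewrite /= in_itv/= ?andbT; lra.
have -> : (1 \in `]-oo, (2^-1 - e)]%classic) = (0 \in `[(2^-1 + e), +oo[%classic).
  by apply/idP/idP => /set_mem; rewrite /= in_itv/= ?andbT => h; apply/mem_set;
    rewrite /= in_itv/= ?andbT; lra.
ring.
Qed.

Lemma le_three_point_mean (f g : R -> R) :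
  f 0 <= g 0 -> f 2^-1 <= g 2^-1 -> f 1 <= g 1 ->
  three_point_mean f <= three_point_mean g.
Proof.
by move=> f0 f2 f1; rewrite /three_point_mean !lerD// ler_wpM2l.
Qed.

Import HBNNSimple.

Let mean_nnsfun (h : {nnsfun R >-> R}) :
  sintegral three_point h = (three_point_mean h)%:E.
Proof.
have := integral_nnsfun three_point measurableT h; rewrite patch_setT => <-.
pose g (x : R) : \bar R := (h x)%:E.
have mh : measurable_fun setT g by exact/measurable_EFinP.
have h0 x : setT x -> (0 <= g x)%E by rewrite /= lee_fin.
rewrite (@ge0_integral_measure_add _ _ _ _ _ setT measurableT g h0 mh).
rewrite (@ge0_integral_measure_add _ _ _ _ _ setT measurableT g h0 mh).
rewrite !(@ge0_integral_mscale _ _ _ _ setT measurableT _ g mh h0).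
by rewrite !integral_dirac// !diracT !mul1e.
Qed.

(* No measurability of [f] is needed, so none has to be proved for the sorted
   samples: [f] is bounded below by a simple function with the same values at
   the atoms. *)
Let ge0_integral_three_point (f : R -> R) : (forall x, 0 <= f x) ->
  (\int[three_point]_x (f x)%:E = (three_point_mean f)%:E)%E.
Proof.
move=> f0; rewrite ge0_integralTE; last by move=> x; rewrite lee_fin.
apply/eqP; rewrite eq_le; apply/andP; split.
  apply: ge_ereal_sup => /= _ [h /= hf <-].
  by rewrite mean_nnsfun lee_fin le_three_point_mean// -lee_fin.
pose point a := scale_nnsfun (indic_nnsfun R (measurable_set1 a)) (f0 a).
pose h := add_nnsfun (add_nnsfun (point 0) (point 2^-1)) (point 1).
have hE x : h x = f 0 * (x == 0)%:R + f 2^-1 * (x == 2^-1)%:R + f 1 * (x == 1)%:R.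
  rewrite -[LHS]/(f 0 * \1_[set 0] x + f 2^-1 * \1_[set 2^-1] x + f 1 * \1_[set 1] x).
  by rewrite !indicE !classical_sets.in_set1.
have -> : three_point_mean f = three_point_mean h.
  by rewrite /three_point_mean !hE ?atom_eqE ?eqxx /= !mulr0 !mulr1 !addr0 !add0r.
rewrite -mean_nnsfun; apply: ereal_sup_ubound; exists h => // x.
rewrite lee_fin hE.
have [->|x0] := eqVneq x 0; first by rewrite ?atom_eqE ?eqxx /= !mulr0 !mulr1 !addr0.
have [->|x2] := eqVneq x 2^-1; first by rewrite ?atom_eqE ?eqxx /= !mulr0 !mulr1 !addr0 add0r.
have [->|x1] := eqVneq x 1; first by rewrite /= !mulr0 !mulr1 !add0r.
by rewrite !mulr0 !addr0.
Qed.

Lemma integral_three_point (f : R -> R) :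
  (\int[three_point]_x (f x)%:E = (three_point_mean f)%:E)%E.
Proof.
rewrite integralE.
pose g := fun x => Num.max (f x) 0; pose k := fun x => Num.max (- f x) 0.
rewrite [X in (X - _)%E](_ : _ = \int[three_point]_x (g x)%:E)%E; last first.
  by apply: eq_integral => x _; rewrite funeposE EFin_max.
rewrite [X in (_ - X)%E](_ : _ = \int[three_point]_x (k x)%:E)%E; last first.
  by apply: eq_integral => x _; rewrite funenegE EFin_max EFinN.
rewrite !ge0_integral_three_point; do ?by move=> x; rewrite le_max lexx orbT.
rewrite -EFinB; congr EFin.
have fE x : f x = g x - k x.
  rewrite /g /k; have [f0|/ltW f0] := leP 0 (f x).
    by rewrite max_r ?subr0// oppr_le0.
  by rewrite max_l ?oppr_ge0// sub0r opprK.
by rewrite /three_point_mean !fE; ring.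
Qed.

End three_point.

(** * Expected order statistics of i.i.d. three-point samples *)

Section sample_mean.
Context {R : realType} (p : {i01 R}).
Implicit Types (k n m : nat) (f g : seq R -> R).

Fixpoint sample_mean k f : R :=
  if k is k'.+1 then
    three_point_mean p (fun x => sample_mean k' (fun s => f (x :: s)))
  else f [::].

Lemma iexp_three_point k f :
  iexp (three_point p) k (fun s => (f s)%:E) = (sample_mean k f)%:E.
Proof.
elim: k f => [//|k IH] f /=.
by rewrite -integral_three_point; apply: eq_integral => x _; rewrite IH.
Qed.

Let atom : pred R := [pred x | [|| x == 0, x == 2^-1 | x == 1]].

(** [three_point_mean] evaluates its argument only at the three atoms, so pointwise claims need
    checking only on samples made of atoms, where sorting is explicit. *)
Lemma le_sample_mean k f g :
    (forall s, size s = k -> all atom s -> f s <= g s) ->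
  sample_mean k f <= sample_mean k g.
Proof.
elim: k f g => [|k IH] f g fg /=; first exact: fg.
by apply: le_three_point_mean; apply: IH => s sk sa; apply: fg;
  rewrite /= ?sk ?sa /atom /= ?eqxx ?orbT.
Qed.

Lemma eq_sample_mean k f g :
    (forall s, size s = k -> all atom s -> f s = g s) ->
  sample_mean k f = sample_mean k g.
Proof.
by move=> fg; apply: le_anti; rewrite !le_sample_mean// => s sk sa;
  rewrite fg.
Qed.

Lemma sample_mean_cst k c : sample_mean k (fun=> c) = c.
Proof. by elim: k => [//|k /= ->]; rewrite /three_point_mean; field. Qed.

Lemma sample_meanD k f g :
  sample_mean k (fun s => f s + g s) = sample_mean k f + sample_mean k g.
Proof.
by elim: k f g => [//|k IH] f g /=; rewrite /three_point_mean !IH; ring.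
Qed.

Lemma sample_meanZ k c f :
  sample_mean k (fun s => c * f s) = c * sample_mean k f.
Proof.
by elim: k f => [//|k IH] f /=; rewrite /three_point_mean !IH; ring.
Qed.

Lemma sample_mean_sum k n (f : 'I_n -> seq R -> R) :
  sample_mean k (fun s => \sum_(i < n) f i s) =
  \sum_(i < n) sample_mean k (f i).
Proof.
elim: n f => [|n IH] f.
  rewrite big_ord0 -[RHS](sample_mean_cst k); apply: eq_sample_mean => s _ _.
  by rewrite big_ord0.
rewrite big_ord_recl -IH -sample_meanD; apply: eq_sample_mean => s _ _.
by rewrite big_ord_recl.
Qed.

Lemma sample_mean_cat n m f :
  sample_mean (n + m) f =
  sample_mean n (fun s => sample_mean m (fun t => f (s ++ t))).
Proof. by elim: n f => [//|n IH] f /=; rewrite /three_point_mean !IH. Qed.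

(** The samples split into the [i] blocks before voter [i], the block of [i] and the [n - i.+1]
    blocks after it; the outer ones average out as constants. *)
Lemma sample_mean_block n m i f : (i < n)%N ->
  sample_mean (n * m) (fun s => f (take m (drop (i * m) s))) = sample_mean m f.
Proof.
move=> ltin; have -> : (n * m = i * m + (m + (n - i.+1) * m))%N by nia.
rewrite sample_mean_cat -[RHS](sample_mean_cst (i * m)).
apply: eq_sample_mean => s si _; rewrite sample_mean_cat.
apply: eq_sample_mean => t tm _; rewrite -[RHS](sample_mean_cst ((n - i.+1) * m)).
apply: eq_sample_mean => r _ _.
by rewrite drop_size_cat// take_size_cat.
Qed.

Lemma sample_mean_reflect k f :
  sample_mean k (fun s => f (map (fun x => 1 - x) s)) = sample_mean k f.
Proof.
elim: k f => [//|k IH] f /=; rewrite /three_point_mean !(IH (fun s => f (_ :: s))).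
have -> : 1 - 2^-1 = 2^-1 :> R by lra.
by rewrite subr0 subrr; ring.
Qed.

(** This is the generating function of a binomial variable with parameters [k] and [p / 2]. It is
    used at [c = 0], where it gives the probability of seeing no 1, and at [c = 1 / 2], for an
    exponential tail bound. *)
Lemma sample_mean_exp k c :
  sample_mean k (fun s => c ^+ count_mem 1 s) =
  (1 - p%:num / 2 * (1 - c)) ^+ k.
Proof.
elim: k => [|k IH] /=; first by rewrite expr0.
rewrite /three_point_mean !atom_eqE eqxx /= IH.
under eq_sample_mean do rewrite exprD expr1.
by rewrite sample_meanZ IH exprS; field.
Qed.

Lemma sample_mean_count k :
  sample_mean k (fun s => (count_mem 1 s)%:R) = k%:R * (p%:num / 2).
Proof.
elim: k => [|k IH] /=; first by rewrite mul0r.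
rewrite /three_point_mean !atom_eqE eqxx /= IH.
under eq_sample_mean do rewrite natrD.
by rewrite sample_meanD sample_mean_cst IH -natr1; field.
Qed.

Definition order_stat k (s : seq R) : R :=
  nth 0 (sort (fun x y : R => y <= x) s) k.

Lemma sort_atoms s : all atom s ->
  sort (fun x y : R => y <= x) s =
  nseq (count_mem 1 s) 1 ++ nseq (count_mem 2^-1 s) 2^-1 ++
  nseq (count_mem 0 s) 0.
Proof.
move=> sa; set t := RHS.
have ge_trans : transitive (fun x y : R => y <= x).
  by move=> x y z yx xz; exact: le_trans xz yx.
have tsort : sorted (fun x y : R => y <= x) t.
  have pw n (x : R) : pairwise (fun x y : R => y <= x) (nseq n x).
    elim: n => //= n ->; rewrite andbT; apply/allP => y /nseqP[-> _].
    exact: lexx.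
  rewrite sorted_pairwise// !pairwise_cat !pw !andbT allrel_catr.
  have ar n m (x y : R) : y <= x ->
      allrel (fun x y : R => y <= x) (nseq n x) (nseq m y).
    by move=> yx; apply/allrelP => a b /nseqP[-> _] /nseqP[-> _].
  by rewrite !ar//; lra.
rewrite -[RHS](sorted_sort ge_trans tsort); apply/perm_sortP => //.
- by move=> x y; exact: le_total.
- by move=> x y; rewrite andbC => /le_anti.
apply/seq.permP => a; rewrite /t !count_cat !count_nseq.
elim: s sa {t tsort} => [|x s IH] /=; first by rewrite !muln0.
move=> /andP[/or3P[]/eqP-> /IH->]; rewrite ?eqxx ?atom_eqE /= ?mulnDr ?muln1 ?muln0; ring.
Qed.

(** The sorted sample is a run of 1s, then of halves, then of 0s. Entry [k] gains one half for lying
    before the end of the 1s and another for lying before the start of the 0s. *)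
Lemma order_stat_atoms k s : all atom s ->
  order_stat k s =
  2^-1 * ((k < count_mem 1%R s)%:R + (k + count_mem 0%R s < size s)%:R).
Proof.
move=> sa; rewrite /order_stat (sort_atoms _ sa).
have -> : size s = (count_mem 1%R s + (count_mem 2^-1 s + count_mem 0%R s))%N.
  by rewrite -(size_sort (fun x y : R => y <= x)) (sort_atoms _ sa) !size_cat !size_nseq.
rewrite !nth_cat !nth_nseq !size_nseq.
set a := count_mem 1%R s; set b := count_mem 2^-1 s; set c := count_mem 0%R s.
have [ka|ak] := ltnP k a.
  have -> : (k + c < a + (b + c))%N by lia.
  by rewrite /=; lra.
have [kb|bk] := ltnP (k - a) b.
  have -> : (k + c < a + (b + c))%N by lia.
  by rewrite /=; lra.
have -> : (k + c < a + (b + c))%N = false by lia.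
by rewrite if_same /=; lra.
Qed.

Definition rank_utility m k : R := sample_mean m (order_stat k).

Lemma Esw_three_point n m (sg : profile n m) j :
  Esw (three_point p) sg j =
  (\sum_(i < n) rank_utility m (rank_pos sg i j))%:E.
Proof.
rewrite /Esw iexp_three_point; congr EFin.
rewrite /sw sample_mean_sum; apply: eq_bigr => i _.
exact: (sample_mean_block _ _ _ (order_stat _)).
Qed.

Lemma rank_utility_antimono m i j : (i <= j)%N ->
  rank_utility m j <= rank_utility m i.
Proof.
move=> ij; apply: le_sample_mean => s sm sa; rewrite !order_stat_atoms//.
rewrite ler_wpM2l ?invr_ge0// lerD// ler_nat.
  by case: (ltnP j) => // jc; rewrite (leq_ltn_trans ij jc).
by case: (ltnP (j + _)) => // jc; rewrite (leq_ltn_trans _ jc)// leq_add2r.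
Qed.

Lemma rank_utility_le1 m k : rank_utility m k <= 1.
Proof.
rewrite -[leRHS](sample_mean_cst m); apply: le_sample_mean => s _ sa.
rewrite order_stat_atoms//.
by case: (_ < _)%N; case: (_ < _)%N => /=; lra.
Qed.

(** The reflection of samples by [1 - x] preserves their law and exchanges the numbers of 0s and 1s,
    so the two order statistics add up to 1 sample by sample. *)
Lemma rank_utility_rev m k : (k < m)%N ->
  rank_utility m (m - k.+1) = 1 - rank_utility m k.
Proof.
move=> km; apply/eqP; rewrite eq_sym subr_eq; apply/eqP.
rewrite -[X in _ + X]sample_mean_reflect -sample_meanD.
rewrite -[LHS](sample_mean_cst m); apply: eq_sample_mean => s sm sa.
have sa' : all atom (map (fun x => 1 - x) s).
  elim: s sa {sm} => //= x s IH /andP[xa /IH->]; rewrite andbT.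
  have e2 : 1 - 2^-1 = 2^-1 :> R by lra.
  by case/or3P: xa => /eqP->; rewrite /atom /= ?subr0 ?subrr ?e2 eqxx ?orbT.
rewrite !order_stat_atoms// size_map !count_map sm.
have -> : count (preim (fun x => 1 - x) (pred1 (1 : R))) s = count_mem 0%R s.
  by apply: eq_count => x /=; apply/eqP/eqP => ?; lra.
have -> : count (preim (fun x => 1 - x) (pred1 (0 : R))) s = count_mem 1%R s.
  by apply: eq_count => x /=; apply/eqP/eqP => ?; lra.
set a := count_mem 1%R s; set c := count_mem 0%R s.
have -> : (m - k.+1 < a)%N = ~~ (k + a < m)%N by lia.
have -> : (m - k.+1 + c < m)%N = ~~ (k < c)%N by lia.
by case: (_ < _)%N; case: (_ < _)%N => /=; lra.
Qed.

Lemma order_stat_ge k s : all atom s ->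
  (k < count_mem 1%R s)%:R <= order_stat k s.
Proof.
move=> sa; rewrite order_stat_atoms//; case: (ltnP k) => /= ks.
  suff -> : (k + count_mem 0%R s < size s)%N by rewrite /=; lra.
  (* The 0s and the 1s are disjoint, so their counts add up to at most the size. *)
  apply: leq_trans (count_size (predU (pred1 (0 : R)) (pred1 (1 : R))) s).
  have := count_predUI (pred1 (0 : R)) (pred1 (1 : R)) s.
  rewrite [X in (_ + X)%N](_ : _ = 0%N).
    by rewrite addn0 => ->; rewrite addnC ltn_add2l.
  rewrite -(count_pred0 s); apply: eq_count => x /=.
  by apply/negbTE/negP => /andP[/eqP-> ]; rewrite atom_eqE.
by case: (_ < _)%N => /=; lra.
Qed.

(** The top sample is 1 as soon as some sample is 1. *)
Lemma rank_utility0_ge m : 1 - (1 - p%:num / 2) ^+ m <= rank_utility m 0.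
Proof.
have -> : 1 - p%:num / 2 = 1 - p%:num / 2 * (1 - 0) by lra.
rewrite -sample_mean_exp.
rewrite -[X in X - _](sample_mean_cst m) -mulN1r -sample_meanZ -sample_meanD.
apply: le_sample_mean => s _ sa; apply: le_trans (order_stat_ge _ _ sa).
by case: (count_mem _ _) => [|a]; rewrite ?expr0 ?exprS ?mul0r /=; lra.
Qed.

(** A Chernoff-type bound: with [a] the number of 1s, the indicator of [a <= k] is at most
    [2 ^ (k - a)]. *)
Lemma rank_utility_ge m k :
  1 - 2 ^+ k * (1 - p%:num / 4) ^+ m <= rank_utility m k.
Proof.
have -> : 1 - p%:num / 4 = 1 - p%:num / 2 * (1 - 2^-1) by lra.
rewrite -sample_mean_exp.
rewrite -[X in X - _](sample_mean_cst m) -mulNr -sample_meanZ -sample_meanD.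
apply: le_sample_mean => s _ sa; apply: le_trans (order_stat_ge _ _ sa).
rewrite mulNr; case: ltnP => /= ks.
  by rewrite gerBl mulr_ge0// exprn_ge0// invr_ge0.
by rewrite subr_le0 exprVn ler_pdivlMr ?exprn_gt0// mul1r ler_weXn2l// ler1n.
Qed.

(** Markov's inequality for the event of at least [k.+1] ones accounts for one half of the utility;
    the other half is bounded by [1 / 2] outright. *)
Lemma rank_utility_le m k :
  rank_utility m k <= 2^-1 + m%:R * p%:num / (4 * k.+1%:R).
Proof.
have -> : m%:R * p%:num / (4 * k.+1%:R) =
    (2 * k.+1%:R)^-1 * (m%:R * (p%:num / 2)) :> R.
  by field; rewrite nat1r pnatr_eq0.
rewrite -sample_mean_count -[X in X + _](sample_mean_cst m).
rewrite -sample_meanZ -sample_meanD.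
apply: le_sample_mean => s _ sa; rewrite order_stat_atoms// mulrDr addrC.
apply: lerD; first by case: (_ < _)%N => /=; lra.
rewrite invfM -mulrA ler_wpM2l ?invr_ge0//.
rewrite mulrC ler_pdivlMr ?ltr0n//.
by case: ltnP => /= ks; rewrite ?mul1r ?mul0r ?ler_nat.
Qed.

End sample_mean.

(** * The profile and the welfare of its alternatives *)

Section hard_profile.
Variables (K L m : nat) (q : 'I_m.+1).

(* [flip_pos] and [flip_pos_fix] give positions of alternatives; x and y are the
   alternatives [ord0] and [q]. *)
Definition flip_pos : {perm 'I_m.+1} :=
  (perm rev_ord_inj * tperm ord_max (rev_ord q))%g.

Definition flip_pos_fix : {perm 'I_m.+1} := (flip_pos * tperm ord_max q)%g.

(** The inverses turn positions of alternatives into rankings. In the second half, [K] voters keep y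
    at position [q] and [L] put it last, so kappa is [K / (K + L)]. *)
Definition hard_profile : profile ((K + L) + (K + L)) m.+1 :=
  [ffun i => match fintype.split i with
             | inl _ => 1%g
             | inr i' => if fintype.split i' is inl _ then flip_pos_fix^-1%g
                         else flip_pos^-1%g
             end].

Hypotheses (q_gt0 : (0 < q)%N) (q_lt : (q < m - q)%N).

Lemma flip_pos0 : flip_pos ord0 = rev_ord q.
Proof.
rewrite /flip_pos permM (permE rev_ord_inj) (_ : rev_ord ord0 = ord_max) ?tpermL//.
by apply: val_inj; rewrite /= subn1.
Qed.

Lemma flip_pos_fix0 : flip_pos_fix ord0 = rev_ord q.
Proof.
rewrite /flip_pos_fix permM flip_pos0 tpermD// -val_eqE /= subSS; lia.
Qed.

Lemma flip_posq : flip_pos q = ord_max.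
Proof. by rewrite /flip_pos permM (permE rev_ord_inj) tpermR. Qed.

Lemma flip_pos_fixq : flip_pos_fix q = q.
Proof. by rewrite /flip_pos_fix permM flip_posq tpermL. Qed.

Lemma flip_posE j : j != ord0 -> j != q -> flip_pos j = rev_ord j.
Proof.
move=> j0 jq; rewrite /flip_pos permM (permE rev_ord_inj) tpermD//.
  by move: j0; rewrite -!val_eqE /= subSS; have := ltn_ord j; lia.
by rewrite (inj_eq rev_ord_inj) eq_sym.
Qed.

(** Bringing y back from the last position to [q] displaces only the alternative at position [q],
    which moves to the end. *)
Lemma flip_pos_fix_ge j : j != ord0 -> j != q -> (rev_ord j <= flip_pos_fix j)%N.
Proof.
move=> j0 jq; rewrite /flip_pos_fix permM flip_posE//.
case: tpermP => [/(congr1 val) /=|_ /=|//]; last by rewrite subSS leq_subr.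
by move: j0; rewrite -val_eqE /= subSS; have := ltn_ord j; lia.
Qed.

Context {R : realType} (p : {i01 R}).
Local Notation u := (rank_utility p m.+1).
Local Notation W j := (Esw (three_point p) hard_profile j).

Lemma Esw_hard_profile j :
  W j = ((K + L)%:R * u j + K%:R * u (flip_pos_fix j) + L%:R * u (flip_pos j))%:E.
Proof.
rewrite Esw_three_point; congr EFin; rewrite big_split_ord /=.
rewrite [X in _ + X]big_split_ord /= addrA; congr (_ + _ + _).
- under eq_bigr => i _.
    rewrite /rank_pos ffunE (unsplitK (inl i)) invg1 perm1; over.
  by rewrite sumr_const card_ord mulr_natl.
- under eq_bigr => i _.
    rewrite /rank_pos ffunE (unsplitK (inr (lshift L i))) (unsplitK (inl i)) invgK; over.
  by rewrite sumr_const card_ord mulr_natl.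
- under eq_bigr => i _.
    rewrite /rank_pos ffunE (unsplitK (inr (rshift K i))) (unsplitK (inr i)) invgK; over.
  by rewrite sumr_const card_ord mulr_natl.
Qed.

Let u_rev (j : 'I_m.+1) : u (rev_ord j) = 1 - u j.
Proof. exact/rank_utility_rev/ltn_ord. Qed.

Lemma Esw_hard_profile0 : W ord0 = ((K + L)%:R * (1 + u 0 - u q))%:E.
Proof.
rewrite Esw_hard_profile flip_pos_fix0 flip_pos0 u_rev; congr EFin => /=.
by rewrite natrD; ring.
Qed.

Lemma Esw_hard_profileq :
  W q = ((K + L + K)%:R * u q + L%:R * (1 - u 0))%:E.
Proof.
rewrite Esw_hard_profile flip_pos_fixq flip_posq; congr EFin => /=.
rewrite (_ : u m = 1 - u 0) ?natrD; first by ring.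
by rewrite -rank_utility_rev// subn1.
Qed.

(** A voter of the second half puts [j] at the mirror image of its position in the first half, or
    later, so a pair of voters contributes at most [u j + (1 - u j)]. *)
Lemma Esw_hard_profile_le j : j != ord0 -> j != q -> (W j <= (K + L)%:R%:E)%E.
Proof.
move=> j0 jq; rewrite Esw_hard_profile flip_posE// lee_fin u_rev.
have := rank_utility_antimono p m.+1 _ _ (flip_pos_fix_ge j j0 jq).
by rewrite u_rev => /(ler_wpM2l (ler0n R K)); rewrite natrD; lra.
Qed.

End hard_profile.

(** * Choice of the numerical parameters *)

Lemma expr1B_mul_le1 {R : realDomainType} (x : R) n :
  0 <= x <= 1 -> (1 - x) ^+ n * (1 + n%:R * x) <= 1.
Proof.
move=> /andP[x0 x1]; elim: n => [|n IH]; first by rewrite expr0 mul0r addr0 mulr1.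
(* What remains is [(1 - x) * (1 + n.+1 * x) <= 1 + n * x]. *)
apply: le_trans IH; rewrite exprSr -mulrA.
rewrite ler_wpM2l ?exprn_ge0 ?subr_ge0// -natr1.
have := ler0n R n; nra.
Qed.

Definition one01 {R : realType} : {i01 R} := Itv01 ler01 (lexx 1).

(** With [l = 1 / d], first [k > l ^ 2] is chosen as [q], then [m] large in terms of [k], then
    [p = 2 * l / m.+1]. The three errors are at most [1 / (1 + l)], [l / (2 * k.+1)] and
    [2 ^ k / (1 + m.+1 / 4)], hence at most [d]; powers are bounded by [expr1B_mul_le1]. *)
Lemma exists_separating_parameters {R : realType} (d : R) : 0 < d ->
  exists m (q : 'I_m.+1) (p : {i01 R}), [/\ (0 < q)%N, (q < m - q)%N &
   [/\ 1 - d <= rank_utility p m.+1 0,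
       rank_utility p m.+1 q <= 2^-1 + d &
       1 - d <= rank_utility one01 m.+1 q]].
Proof.
move=> d0.
pose l := d^-1.
have l0 : 0 < l by rewrite invr_gt0.
have dl : d * l = 1 by rewrite mulfV ?gt_eqF.
have [k k0 lk] : exists2 k : nat, (0 < k)%N & l * l < k%:R.
  by exists (Num.truncn (l * l)).+1 => //; exact: Num.Theory.truncnS_gt.
have [m km lm] : exists2 m : nat, (k < m - k)%N &
    2 * l + 4 * 2 ^+ k * l < m.+1%:R.
  set b := 2 * l + _; exists (Num.truncn b + 2 * k + 2)%N; first by lia.
  apply: lt_trans (Num.Theory.truncnS_gt b) _.
  by rewrite ltr_nat ltnS -addnA addn2 addnS ltnS leq_addr.
have km1 : (k < m.+1)%N by lia.
have pow0 : 0 < 2 ^+ k :> R by rewrite exprn_gt0.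
have m0 : 0 < m.+1%:R :> R by rewrite ltr0n.
have [e me /andP[e0 e1]] : exists2 e : R, m.+1%:R * e = 2 * l & 0 <= e <= 1.
  exists (2 * l / m.+1%:R); first by field; rewrite gt_eqF.
  apply/andP; split; first by rewrite divr_ge0 ?mulr_ge0// ltW.
  by rewrite ler_pdivrMr// mul1r; nra.
exists m, (Ordinal km1), (Itv01 e0 e1); split => //; split.
- apply: le_trans (rank_utility0_ge _ _); rewrite lerD2l lerN2.
  rewrite [X in X / 2](_ : _ = e)//; set x := e / 2.
  have mx : m.+1%:R * x = l by rewrite /x; lra.
  have x01 : 0 <= x <= 1 by rewrite /x; lra.
  have := expr1B_mul_le1 x m.+1 x01; rewrite mx => h.
  have : 0 <= (1 - x) ^+ m.+1 by rewrite exprn_ge0//; lra.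
  by move: h; set y := _ ^+ _; nra.
- apply: le_trans (rank_utility_le _ _ _) _; rewrite lerD2l me.
  rewrite ler_pdivrMr ?mulr_gt0 ?ltr0n//.
  have : k%:R <= k.+1%:R :> R by rewrite ler_nat.
  by nra.
- apply: le_trans (rank_utility_ge _ _ _); rewrite lerD2l lerN2.
  rewrite [X in X / 4](_ : _ = 1)// mul1r.
  have x01 : 0 <= (4^-1 : R) <= 1 by lra.
  have := expr1B_mul_le1 _ m.+1 x01.
  have : 0 <= (1 - 4^-1) ^+ m.+1 :> R by rewrite exprn_ge0//; lra.
  set y := _ ^+ m.+1; set z := 2 ^+ k in lm pow0 * => y0 h.
  have : y * (z * l) <= 1.
    by apply: le_trans h; rewrite ler_wpM2l//; nra.
  by nra.
Qed.

Lemma exists_mixing_ratio {R : realType} (alpha : R) :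
  Num.sqrt (3^-1) < alpha ->
  exists K L : nat, (0 < K + L)%N /\
    (K + L)%:R < alpha * (K + L + K)%:R /\
    (K + L + K)%:R < 3 * alpha * (K + L)%:R.
Proof.
set s := Num.sqrt _ => sa.
have s0 : 0 < s by rewrite sqrtr_gt0; lra.
have s2 : s * s = 3^-1 by rewrite -expr2 sqr_sqrtr//; lra.
have s_lb : 2^-1 < s by nra.
(* Since [3 * s = sqrt 3], this bound makes the ideal ratio [K / N = 3 * s - 1] less than 1. *)
have s_ub : s < 2 / 3 by nra.
pose N := (Num.truncn (alpha / (3 * s * (alpha - s)))).+1.
(* [N] is so large that the gain [3 * s * N * (alpha - s)] exceeds [alpha], the most that rounding
   [K] down can cost. *)
have N0 : 0 < N%:R :> R by rewrite ltr0n.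
have NP : alpha < N%:R * (3 * s * (alpha - s)).
  rewrite -ltr_pdivrMr; first exact: Num.Theory.truncnS_gt.
  by rewrite !mulr_gt0//; lra.
pose K := Num.truncn (N%:R * (3 * s - 1)).
have /andP[K_le K_gt] : K%:R <= N%:R * (3 * s - 1) < K.+1%:R.
  by apply: Num.Theory.truncn_itv; rewrite mulr_ge0//; lra.
have KN : (K <= N)%N by rewrite -(ler_nat R); nra.
exists K, (N - K)%N; rewrite subnKC//; split => //.
rewrite natrD; move: K_gt; rewrite -natr1 => K_gt.
by split; nra.
Qed.

(** * Contradiction from one profile under two distributions *)

Theorem theorem6 (R : realType) (alpha : R) :
  Num.sqrt (3^-1) < alpha ->
  ~ exists f : voting_rule,
      forall (n m : nat) (D : probability R R),
        supported01 D -> symmetric_distr D ->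
        forall sg : profile n m.+1,
          (alpha%:E * \big[Order.max/-oo%E]_(j < m.+1) Esw D sg j
             <= Esw D sg (f n m sg))%E.
Proof.
move=> sa [f f_opt].
have a0 : 0 < alpha by apply: le_lt_trans sa; exact: sqrtr_ge0.
have [K [L [N0 [K_lb K_ub]]]] := exists_mixing_ratio _ sa.
set N := (K + L)%:R in K_lb K_ub; set NK := (K + L + K)%:R in K_lb K_ub.
have N_gt0 : 0 < N by rewrite ltr0n.
have NK_ge : N <= NK by rewrite ler_nat leq_addr.
have NKL : NK + L%:R = 2 * N by rewrite /NK /N !natrD; ring.
(* [B] adds up the coefficients of [d] in the errors of the two cases below, and [c] is the smaller
   of their slacks. *)
pose B := 4 * (1 + alpha) * N + alpha * NK + N.
have B_gt0 : 0 < B by rewrite /B; nra.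
pose c := Num.min (3 * alpha * N - NK) (alpha * NK - N).
have c_gt0 : 0 < c by rewrite lt_min !subr_gt0 K_ub K_lb.
pose d := c / (2 * B).
have d_gt0 : 0 < d by rewrite divr_gt0// mulr_gt0.
have dB : d * B < c.
  have -> : d * B = c / 2 by rewrite /d; field; rewrite gt_eqF.
  lra.
have [c1 c2] : c <= 3 * alpha * N - NK /\ c <= alpha * NK - N.
  by rewrite !ge_min !lexx ?orbT.
have NK_gt0 : 0 < NK by lra.
have aN_gt0 : 0 < alpha * N by rewrite mulr_gt0.
have aNKd_gt0 : 0 < alpha * NK * d by apply: mulr_gt0 => //; exact: mulr_gt0.
have Nd_gt0 : 0 < N * d by rewrite mulr_gt0.
have aNd_gt0 : 0 < alpha * N * d by rewrite mulr_gt0.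
have [m [q [p [q0 qm [u0 uq vq]]]]] := exists_separating_parameters _ d_gt0.
set sg := hard_profile K L m q; set w := f _ _ sg.
(* The choice [w] does not depend on [r], since the rule sees only the profile. *)
have opt (r : {i01 R}) j :
    (alpha%:E * Esw (three_point r) sg j <= Esw (three_point r) sg w)%E.
  apply: le_trans (f_opt _ _ _ (supported01_three_point r)
                         (symmetric_three_point r) sg).
  apply: lee_wpmul2l; first by rewrite lee_fin ltW.
  exact: (le_bigmax -oo%E (fun j => Esw (three_point r) sg j) j).
(* If y is chosen, it is compared with x under small [p]. *)
have [wq|wq] := eqVneq w q.
  have := opt p ord0; rewrite wq Esw_hard_profile0// Esw_hard_profileq//.
  rewrite -EFinM lee_fin -/N -/NK; move: u0 uq.
  set x := rank_utility _ _ _; set y := rank_utility _ _ _ => xd yd.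
  have := ler_wpM2l (ltW aN_gt0) (_ : 3 / 2 - 2 * d <= 1 + x - y).
  have := ler_wpM2l (ltW NK_gt0) yd.
  have := ler_wpM2l (ler0n R L) (_ : 1 - x <= d).
  have : L%:R * d = 2 * N * d - NK * d by rewrite -NKL; ring.
  move: aN_gt0 aNKd_gt0 Nd_gt0 aNd_gt0 dB c1; rewrite /B => *; lra.
(* Any other choice is compared with y under [p = 1]. *)
have := opt one01 q.
rewrite Esw_hard_profileq// -EFinM -/NK.
set x := rank_utility _ _ 0; set y := rank_utility _ _ q in vq *.
have x1 : x <= 1 by exact: rank_utility_le1.
have y_ge : alpha * NK * (1 - d) <= alpha * (NK * y + L%:R * (1 - x)).
  rewrite -mulrA; apply: ler_wpM2l; first exact: ltW.
  have := ler_wpM2l (ltW NK_gt0) vq.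
  by have : 0 <= L%:R * (1 - x); [rewrite mulr_ge0// subr_ge0 | lra].
suff w_le : (Esw (three_point one01) sg w <=
             (N * (1 + d))%R%:E)%E.
  move=> /le_trans/(_ w_le); rewrite lee_fin => /(le_trans y_ge).
  move: Nd_gt0 aNd_gt0 dB c2; rewrite /B => *; lra.
have [->|w0] := eqVneq w ord0.
  rewrite Esw_hard_profile0// lee_fin -/x -/y -/N ler_wpM2l ?ler0n//; lra.
apply: (le_trans (Esw_hard_profile_le _ _ _ _ q0 qm _ _ w0 wq)).
by rewrite lee_fin -/N mulrDr mulr1 lerDl ltW.
Qed.
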